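(* Let $n$ be a positive integer and let $G$ be a simple graph. Then $G$ is isomorphic to the triangular book graph $B_n$ if and only if $$[x]\,da(G;x,y) = 2y + n\,y^{n}.$$
   Context: All graphs are finite, simple and have at least one vertex. For a graph $G$, $S\subseteq V(G)$ and $u\in V(G)$, let $\bar S=V(G)\setminus S$, let $\delta_S(u)=|\{v\in S:\{u,v\}\in E(G)\}|$, and let $G[S]$ be the subgraph induced by $S$. The defensive alliance polynomial of $G$ is $$da(G;x,y)=\sum_{S} x^{|S|}\,y^{f_y(S)},\qquad f_y(S)=\min_{u\in S}\bigl(\delta_S(u)-\delta_{\bar S}(u)+|V(G)|\bigr),$$ where the sum runs over all non-empty $S\subseteq V(G)$ such that $G[S]$ is connected (single-vertex graphs are connected). $[x^k]\,da(G;x,y)$ denotes the coefficient of $x^k$ in $da(G;x,y)$, which is a polynomial in $y$. The triangular book graph $B_n$ is the graph join $nK_1+K_2$, i.e. two adjacent vertices together with $n$ pairwise non-adjacent vertices, each adjacent to both of them (so it has $n+2$ vertices). *)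

(* Defs.v *)
From HB Require Import structures.
From mathcomp Require Import all_boot all_order all_algebra.

Set Implicit Arguments.
Unset Strict Implicit.
Unset Printing Implicit Defensive.

Import GRing.Theory.
Local Open Scope ring_scope.

(* The empty graph is not excluded here; nonemptiness is assumed separately. *)
Record sgraph := SGraph {
  svertex :> finType;
  sedge : rel svertex;
  sedge_sym : symmetric sedge;
  sedge_irr : irreflexive sedge }.

Definition isomorphic (G H : sgraph) : Prop :=
  exists2 f : G -> H, bijective f & {mono f : u v / sedge u v}.

Section Constructions.

Definition edgeless_rel (n : nat) : rel 'I_n := fun _ _ => false.

Fact edgeless_sym n : symmetric (@edgeless_rel n). Proof. by []. Qed.

Fact edgeless_irr n : irreflexive (@edgeless_rel n). Proof. by []. Qed.

(* The disjoint union n K_1 of n isolated vertices. *)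
Definition edgeless (n : nat) : sgraph :=
  SGraph (@edgeless_sym n) (@edgeless_irr n).

Definition complete_rel (n : nat) : rel 'I_n := fun u v => u != v.

Fact complete_sym n : symmetric (@complete_rel n).
Proof. by move=> u v; rewrite /complete_rel eq_sym. Qed.

Fact complete_irr n : irreflexive (@complete_rel n).
Proof. by move=> u; rewrite /complete_rel eqxx. Qed.

Definition complete (n : nat) : sgraph :=
  SGraph (@complete_sym n) (@complete_irr n).

Definition join_rel (G H : sgraph) : rel (G + H)%type := fun u v =>
  match u, v with
  | inl a, inl b => sedge a b
  | inr a, inr b => sedge a b
  | _, _ => true
  end.

Fact join_sym G H : symmetric (@join_rel G H).
Proof. by case=> a [] b //=; rewrite sedge_sym. Qed.

Fact join_irr G H : irreflexive (@join_rel G H).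
Proof. by case=> a /=; rewrite sedge_irr. Qed.

Definition join (G H : sgraph) : sgraph :=
  SGraph (@join_sym G H) (@join_irr G H).

Definition triangular_book (n : nat) : sgraph := join (edgeless n) (complete 2).

Definition induced_rel (G : sgraph) (S : {set G}) : rel {u : G | u \in S} :=
  fun u v => sedge (val u) (val v).

Fact induced_sym G S : symmetric (@induced_rel G S).
Proof. by move=> u v; apply: sedge_sym. Qed.

Fact induced_irr G S : irreflexive (@induced_rel G S).
Proof. by move=> u; apply: sedge_irr. Qed.

Definition induced (G : sgraph) (S : {set G}) : sgraph :=
  SGraph (@induced_sym G S) (@induced_irr G S).

End Constructions.

Definition connected (G : sgraph) : bool :=
  [forall u : G, forall v : G, connect (@sedge G) u v].

Definition deg_in (G : sgraph) (S : {set G}) (u : G) : nat :=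
  #|[set v in S | sedge u v]|.

(* deg_in S u - deg_in (~: S) u + #|G|: since deg_in (~: S) u <= #|G|, adding
   #|G| before subtracting makes the truncated subtraction on nat exact. *)
Definition defect (G : sgraph) (S : {set G}) (u : G) : nat :=
  (deg_in S u + #|G| - deg_in (~: S) u)%N.

(* 2 * #|G| bounds every value of [defect], so as the neutral element it does
   not affect the minimum over a nonempty S. *)
Definition alliance_exp (G : sgraph) (S : {set G}) : nat :=
  \big[minn/(2 * #|G|)%N]_(u in S) defect S u.

Fact defectE (G : sgraph) (S : {set G}) (u : G) :
  (defect S u)%:Z = (deg_in S u)%:Z - (deg_in (~: S) u)%:Z + #|G|%:Z.
Proof.
rewrite /defect -subzn; first by rewrite PoszD addrAC.
by apply: leq_trans (leq_addl _ _); apply: max_card.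
Qed.

Fact alliance_exp_le (G : sgraph) (S : {set G}) (u : G) :
  u \in S -> (alliance_exp S <= defect S u)%N.
Proof.
move=> uS; rewrite /alliance_exp -minEnat -leEnat.
exact: Order.TotalTheory.bigmin_le_cond.
Qed.

Fact alliance_exp_attained (G : sgraph) (S : {set G}) :
  S != set0 -> exists2 u, u \in S & alliance_exp S = defect S u.
Proof.
case/set0Pn=> u0 u0S.
have [u uS min_u] := arg_minnP (defect S) u0S.
exists u => //; apply/eqP; rewrite eqn_leq alliance_exp_le //=.
rewrite /alliance_exp; elim/big_ind: _ => [|a b ua ub|v vS].
- apply: leq_trans (leq_subr _ _) _.
  by rewrite mul2n -addnn leq_add2r; apply: max_card.
- by rewrite leq_min ua.
- exact: min_u.
Qed.

(* The outer variable of {poly {poly int}} is x, the inner one is y; the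
   exponent of y attached to S is alliance_exp S. *)
Definition da (G : sgraph) : {poly {poly int}} :=
  \sum_(S : {set G} | (S != set0) && connected (induced S))
    ('X^(alliance_exp S))%:P * 'X^#|S|.

(* Main.v *)
Require Import Defs.
From HB Require Import structures.
From mathcomp Require Import all_boot all_order all_algebra.
From mathcomp Require Import zify.

Set Implicit Arguments.
Unset Strict Implicit.
Unset Printing Implicit Defensive.

Import GRing.Theory.
Local Open Scope ring_scope.

(* Only singletons contribute to [x], and {u} contributes y^(|V| - deg u), so
   the coefficient encodes the degree sequence.  For 2y + n y^n, evaluating at
   y = 1 gives |V| = n + 2; two vertices are universal and every other vertex
   has degree 2, hence is adjacent exactly to those two. *)

Lemma isomorphic_sym (G H : sgraph) : isomorphic G H -> isomorphic H G.
Proof.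
case=> f [g fK gK] f_mono; exists g; first by exists f.
by move=> u v; rewrite -f_mono !gK.
Qed.

Lemma deg_in_setT (G : sgraph) (u : G) :
  deg_in [set: G] u = #|[set v | sedge u v]|.
Proof. by apply: eq_card => v; rewrite !inE. Qed.

Lemma isomorphic_deg (G H : sgraph) (f : G -> H) (u : G) :
  bijective f -> {mono f : u v / sedge u v} ->
  deg_in [set: H] (f u) = deg_in [set: G] u.
Proof.
move=> [g fK gK] f_mono; rewrite !deg_in_setT -(card_imset _ (can_inj fK)).
apply: eq_card => w; rewrite inE; apply/idP/imsetP => [uw|[v]].
  by exists (g w); rewrite ?inE -?f_mono ?gK.
by rewrite inE => uv ->; rewrite f_mono.
Qed.

(** There are no loops, so [u] has no neighbour inside [[set u]] and all of its neighbours lie in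
    the complement. *)
Lemma alliance_exp1 (G : sgraph) (u : G) :
  alliance_exp [set u] = (#|G| - deg_in [set: G] u)%N.
Proof.
have [|v /set1P -> ->] := @alliance_exp_attained G [set u].
  by apply/set0Pn; exists u; rewrite set11.
rewrite /defect; congr (_ - _)%N.
  rewrite -[RHS]add0n; congr (_ + _)%N; apply/eqP; rewrite cards_eq0.
  apply/eqP/setP=> w; rewrite !inE; case: eqP => // ->.
  by rewrite sedge_irr.
apply: eq_card => w; rewrite !inE.
by case: eqP => // ->; rewrite sedge_irr.
Qed.

Lemma connected_induced1 (G : sgraph) (u : G) : connected (induced [set u]).
Proof.
apply/forallP=> v; apply/forallP=> w.
suff -> : v = w by apply: connect0.
by apply: val_inj; rewrite /= (set1P (valP v)) (set1P (valP w)).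
Qed.

Lemma da_coef1 (G : sgraph) :
  (da G)`_1 = \sum_(u : G) 'X^(#|G| - deg_in [set: G] u) :> {poly int}.
Proof.
rewrite coef_sum.
(* Each coefficient becomes a conditional on [#|S| == 1], which then moves into the range of the
   sum; the surviving sets are reindexed by the injection [set1]. *)
under eq_bigr do rewrite coefCM coefXn eq_sym mulr_natr mulrb.
rewrite -big_mkcondr /=.
under [RHS]eq_bigr do rewrite -alliance_exp1.
rewrite -(big_imset (fun S => 'X^(alliance_exp S)) (in2W set1_inj)) /=.
apply: eq_bigl => S; apply/idP/imsetP => [/andP[_ /cards1P[u ->]]|[u _ ->]].
  by exists u.
rewrite connected_induced1 cards1 eqxx !andbT.
by apply/set0Pn; exists u; rewrite set11.
Qed.

(** This recovers the multiplicity of each exponent, hence of each degree, from the polynomial. *)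
Lemma coef_sum_Xn (R : nzRingType) (I : finType) (e : I -> nat) (k : nat) :
  (\sum_i 'X^(e i) : {poly R})`_k = #|[set i | e i == k]|%:R.
Proof.
rewrite coef_sum; under eq_bigr do rewrite coefXn eq_sym.
by rewrite -natr_sum -sum1dep_card [in RHS]big_mkcond.
Qed.

Lemma card_triangular_book n : #|triangular_book n| = (n + 2)%N.
Proof. by rewrite card_sum !card_ord. Qed.

Lemma triangular_book_deg_page n (i : edgeless n) :
  deg_in [set: triangular_book n] (inl i) = 2.
Proof.
by rewrite deg_in_setT -sum1dep_card big_sumType big_pred0 //= sum1_card card_ord.
Qed.

Lemma triangular_book_deg_spine n (j : complete 2) :
  deg_in [set: triangular_book n] (inr j) = n.+1.
Proof.
rewrite deg_in_setT -sum1dep_card big_sumType /= sum1_card card_ord.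
rewrite (eq_bigl (predC1 j)) => [|i]; last by rewrite /= /complete_rel eq_sym.
by rewrite sum1_card cardC1 card_ord addn1.
Qed.

(** The two spine vertices have exponent (n+2)-(n+1) = 1, and the n pages have exponent (n+2)-2 =
    n. *)
Lemma da_coef1_triangular_book n :
  (da (triangular_book n))`_1 = 'X *+ 2 + 'X^n *+ n :> {poly int}.
Proof.
rewrite da_coef1 card_triangular_book big_sumType [LHS]addrC; congr (_ + _).
  under eq_bigr do rewrite triangular_book_deg_spine addn2 subSnn expr1.
  by rewrite sumr_const card_ord.
under eq_bigr do rewrite triangular_book_deg_page addnK.
by rewrite sumr_const card_ord.
Qed.

Lemma isomorphic_da_coef1 (G H : sgraph) :
  isomorphic G H -> (da G)`_1 = (da H)`_1.
Proof.
case=> f f_bij f_mono; rewrite !da_coef1 [RHS](reindex f) /=; last exact: onW_bij.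
by apply: eq_bigr => u _; rewrite (isomorphic_deg u f_bij) // (bij_eq_card f_bij).
Qed.

(** The edge condition describes the join of the edge [a b] with an independent set. Pages go to an
    enumeration of the complement of [[set a; b]], the spine to [a] and [b]; by cardinality,
    injectivity suffices. *)
Lemma triangular_book_isomorphic n (G : sgraph) (a b : G) :
  #|G| = (n + 2)%N -> a != b ->
  (forall u v : G, sedge u v =
     (u != v) && ((u \in [set a; b]) || (v \in [set a; b]))) ->
  isomorphic G (triangular_book n).
Proof.
move=> cardG neq_ab edgeE.
have cardC : #|~: [set a; b]| = n.
  by have := cardsC [set a; b]; rewrite cards2 neq_ab cardG; lia.
pose p (i : 'I_n) : G := enum_val (cast_ord (esym cardC) i).
pose s (j : 'I_2) : G := if j == ord0 then a else b.
have p_inj : injective p by move=> i j /enum_val_inj /cast_ord_inj.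
have pN i : p i \notin [set a; b] by rewrite -in_setC enum_valP.
have s_in j : s j \in [set a; b] by rewrite /s !inE; case: ifP; rewrite eqxx ?orbT.
have s_inj : injective s.
  move=> i j; rewrite /s; case: (eqVneq i) => [->|ni]; case: (eqVneq j) => [->|nj] //.
  - by move=> eab; rewrite eab eqxx in neq_ab.
  - by move=> eab; rewrite eab eqxx in neq_ab.
  - by move=> _; apply: val_inj; case: i j ni nj => [[|[|]]] //= ? [[|[|]]].
have ps i j : p i != s j by apply: contraNneq (pN i) => ->.
(* The map is easier to define out of the book, whose vertices form a sum type. *)
apply: isomorphic_sym.
exists (fun x : triangular_book n => match x with inl i => p i | inr j => s j end).
  apply: inj_card_bij; last by rewrite card_triangular_book cardG.
  move=> [i|i] [j|j] eq_ij; first by rewrite (p_inj _ _ eq_ij).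
  - by move/eqP: (ps i j).
  - by case/eqP: (ps j i).
  - by rewrite (s_inj _ _ eq_ij).
move=> [i|i] [j|j]; rewrite edgeE ?s_in ?orbT ?andbT //=.
- by rewrite (negPf (pN i)) (negPf (pN j)) andbF.
- by rewrite ps.
- by rewrite eq_sym ps.
- by rewrite (inj_eq s_inj).
Qed.

(** The neighbourhood of [u] avoids [u] and has [#|G| - 1] elements, so it is everything else. *)
Lemma universal_sedge (G : sgraph) (u v : G) :
  (#|G| - deg_in [set: G] u)%N = 1 -> sedge u v = (u != v).
Proof.
rewrite deg_in_setT => deg_u; set N := [set w | sedge u w] in deg_u.
have sub : N \subset [set~ u].
  by apply/subsetP=> w; rewrite !inE; apply: contraTneq => ->; rewrite sedge_irr.
have /setP/(_ v) : N = [set~ u].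
  apply/eqP; rewrite eqEcard sub cardsC1 -subn1 leq_subLR addnC.
  by rewrite -leq_subLR deg_u.
by rewrite !inE eq_sym.
Qed.

Lemma isomorphic_triangular_book_da n (G : sgraph) : (0 < n)%N ->
  (da G)`_1 = 'X *+ 2 + 'X^n *+ n :> {poly int} ->
  isomorphic G (triangular_book n).
Proof.
move=> n_gt0; rewrite da_coef1; set e := fun u : G => (#|G| - deg_in setT u)%N.
move=> daG.
have cardG : #|G| = (n + 2)%N.
  have := congr1 (fun p : {poly int} => p.[1]) daG.
  rewrite horner_sum; under eq_bigr do rewrite hornerXn expr1n.
  rewrite sumr_const hornerD !hornerMn hornerX hornerXn expr1n -natrD addnC.
  by move/eqP; rewrite Num.Theory.eqr_nat => /eqP.
(* Compare the coefficients of y^k. Adding the two contributions also covers n = 1, where both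
   monomials are multiples of y. *)
have cardE k : #|[set u | e u == k]| = ((k == 1) * 2 + (k == n) * n)%N.
  have := congr1 (fun p : {poly int} => p`_k) daG.
  rewrite coef_sum_Xn coefD !coefMn coefX coefXn -!mulrnA -natrD => /eqP.
  by rewrite Num.Theory.eqr_nat => /eqP.
have : (1 < #|[set u | e u == 1%N]|)%N by rewrite cardE leq_addr.
case/card_gt1P=> a [b] [ea eb neq_ab].
move: (ea) (eb); rewrite !inE => /eqP ea1 /eqP eb1.
have aE v : sedge a v = (a != v) by apply: universal_sedge.
have bE v : sedge b v = (b != v) by apply: universal_sedge.
(* The class of [u] is inhabited, so [e u] is 1 or n. If it were 1 with n different from 1, that
   class would have just two elements, hence be [[set a; b]]. *)
have eN u : u \notin [set a; b] -> e u = n.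
  move=> uN; have : (0 < #|[set v | e v == e u]|)%N.
    by apply/card_gt0P; exists u; rewrite inE.
  rewrite cardE; case: (eqVneq (e u) n) => // ne; case: eqP => // eu1.
  rewrite eu1 in ne; have /eqP eqE : [set a; b] == [set v | e v == 1%N].
    rewrite eqEcard cards2 neq_ab cardE (negPf ne) andbT.
    by apply/subsetP=> v /set2P[] ->.
  by rewrite eqE inE eu1 in uN.
(* Both [a] and [b] are universal, hence neighbours of [u]; a degree of at most 2 leaves room for no
   others. *)
have nbr u v : u \notin [set a; b] -> sedge u v = (v \in [set a; b]).
  move=> uN; have /setP/(_ v) : [set a; b] = [set w | sedge u w].
    apply/eqP; rewrite eqEcard cards2 neq_ab -deg_in_setT; apply/andP; split.
      apply/subsetP=> w; rewrite [w \in [set w | _]]inE sedge_sym.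
      by case/set2P=> ->; rewrite ?aE ?bE; apply: contraNneq uN => <-; rewrite !inE eqxx ?orbT.
    (* Since n > 0, the subtraction in [e u = n] is not truncated, so the degree is exactly 2. *)
    by have := eN u uN; rewrite /e cardG => eun; lia.
  by rewrite [v \in [set w | _]]inE => <-.
apply: (triangular_book_isomorphic cardG neq_ab) => u v.
have [uD|uN] := boolP (u \in [set a; b]).
  by rewrite andbT; case/set2P: uD => ->.
rewrite nbr //=; case: (boolP (v \in _)) => vD; rewrite ?andbF ?andbT //.
by apply/esym; apply: contraNneq uN => ->.
Qed.

Theorem proposition38 (n : nat) (hn : (0 < n)%N) (G : sgraph)
    (hG : (0 < #|G|)%N) :
  isomorphic G (triangular_book n) <->
  (da G)`_1 = 'X *+ 2 + 'X^n *+ n :> {poly int}.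
Proof.
split=> [/isomorphic_da_coef1 ->|]; first exact: da_coef1_triangular_book.
exact: isomorphic_triangular_book_da.
Qed.
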